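(* Let $G$ be a finite simple graph and $k$ a positive integer. Then a $k$-restraint $r$ on $G$ belongs to $R_{\min}(G,k)$ if and only if, for each connected component $H$ of $G$, the restriction of $r$ to $V(H)$ is constant (i.e. $r(u)=r(u')$ for all $u,u'\in V(H)$).
   Context: A restraint $r$ on a graph $G$ assigns to each vertex $v$ a finite set $r(v)\subset\mathbb{N}$ of forbidden colours; a proper $x$-colouring $c$ of $G$ is permitted by $r$ if $c(v)\notin r(v)$ for all $v$, and $\pi_r(G,x)$ denotes the number of proper $x$-colourings permitted by $r$. If $G$ has $n$ vertices, a $k$-restraint is a restraint with $|r(v)|=k$ and $r(v)\subseteq\{1,2,\dots,kn\}$ for every vertex $v$. $R_{\min}(G,k)$ is the set of $k$-restraints $r$ on $G$ such that for every $k$-restraint $r'$ on $G$, $\pi_r(G,x)\leq\pi_{r'}(G,x)$ for all sufficiently large $x$. *)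

(* Defs.v *)
From mathcomp Require Import all_boot finmap.

Set Implicit Arguments.
Unset Strict Implicit.
Unset Printing Implicit Defensive.

Local Open Scope fset_scope.

(* A finite simple graph is a symmetric irreflexive relation e on a finType T;
   the theorem takes symmetry and irreflexivity as hypotheses. *)

Definition restraint (T : finType) := T -> {fset nat}.

(* An x-colouring uses the colours 1, ..., x; the element i of 'I_x stands for
   the colour i.+1. *)
Definition colour (x : nat) (i : 'I_x) : nat := i.+1.

Definition proper_colouring (T : finType) (e : rel T) (x : nat)
    (c : {ffun T -> 'I_x}) : bool :=
  [forall u, forall v, e u v ==> (c u != c v)].

Definition permitted (T : finType) (r : restraint T) (x : nat)
    (c : {ffun T -> 'I_x}) : bool :=
  [forall v, colour (c v) \notin r v].

Definition restrained_count (T : finType) (e : rel T) (r : restraint T)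
    (x : nat) : nat :=
  #|[set c : {ffun T -> 'I_x} | proper_colouring e c & permitted r c]|.

Definition k_restraint (T : finType) (k : nat) (r : restraint T) : Prop :=
  forall v, #|` r v| = k /\ (forall i, i \in r v -> 1 <= i <= k * #|T|).

Definition Rmin (T : finType) (e : rel T) (k : nat) (r : restraint T) : Prop :=
  k_restraint k r /\
  forall r' : restraint T, k_restraint k r' ->
    exists N : nat, forall x : nat, N <= x ->
      restrained_count e r x <= restrained_count e r' x.

(* The vertex sets of the connected components. *)
Definition components (T : finType) (e : rel T) : {set {set T}} :=
  equivalence_partition (connect e) [set: T].

(* Main.v *)
(** Put [K = k * n], so that all forbidden colours are at most [K], and sort the
    permitted proper colourings by the set [W] of vertices whose colour is at
    most [K].  The count becomes the sum over [W] of [a_W(r) * m(W)], where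
    [a_W(r)] counts the admissible low colourings of [W] and [m(W)], the number
    of ways to colour the other vertices with colours above [K], does not depend
    on [r].  For [|W| <= 1] the factor [a_W(r)] is the same for all
    k-restraints, and for [W = {u, v}] it is [(K - k)^2], minus
    [K - |r(u) U r(v)|] if [uv] is an edge; so it is smallest when [r] is constant
    along edges, and strictly larger on an edge with [r(u) <> r(v)].  Since
    [m(W)] has order [x^(n - |W|)], the sets with [|W| >= 3] cannot compensate
    such a strict gain when [x] is large.  Finally, two k-restraints that are
    both constant along edges have equal counts, by permuting the colours
    separately on each component. *)

Require Import Defs.
From mathcomp Require Import all_boot finmap zify.

Set Implicit Arguments.
Unset Strict Implicit.
Unset Printing Implicit Defensive.

(** * Splitting a colouring into low and high colours *)

(** As [i] stands for the colour [i.+1], the colours at most [K] are exactly the [i < K]; [None]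
    marks a vertex with a higher colour. *)
Definition low_part (T : finType) (K x : nat) (c : {ffun T -> 'I_x}) :
    {ffun T -> option 'I_K} :=
  [ffun v => insub (c v : nat)].

Definition low_support (T : finType) (K : nat) (d : {ffun T -> option 'I_K}) :
    {set T} :=
  [set v | d v != None].

(** Properness at an edge is tested here if the first endpoint is low, and in [proper_above] if it
    is high. An edge between a low and a high vertex passes both tests automatically. *)
Definition low_admissible (T : finType) (e : rel T) (r : restraint T) (K : nat)
    (d : {ffun T -> option 'I_K}) : bool :=
  [forall v, if d v is Some i then colour i \notin r v else true] &&
  [forall u, forall v, e u v ==> (d u != None) ==> (d u != d v)].

Definition proper_above (T : finType) (e : rel T) (K x : nat)
    (c : {ffun T -> 'I_x}) : bool :=
  [forall u, forall v, e u v ==> (K <= c u) ==> (c u != c v)].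

Definition low_count (T : finType) (e : rel T) (r : restraint T) (K : nat)
    (W : {set T}) : nat :=
  #|[set d : {ffun T -> option 'I_K} |
      low_admissible e r d & low_support d == W]|.

Definition extensions (T : finType) (e : rel T) (K x : nat)
    (d : {ffun T -> option 'I_K}) : {set {ffun T -> 'I_x}} :=
  [set c | low_part K c == d & proper_above e K c].

(** For [K <= x] all terms of the maximum are equal, so it is their common value, obtained without
    choosing a representative [d]; it is 0 if no [d] has support [W]. *)
Definition high_count (T : finType) (e : rel T) (K x : nat) (W : {set T}) :
    nat :=
  \max_(d : {ffun T -> option 'I_K} | low_support d == W)
    #|extensions e x d|.

Definition edge_constant (T : finType) (e : rel T) (r : restraint T) : Prop :=
  forall u v, e u v -> r u = r v.

Definition free_colours (T : finType) (r : restraint T) (K : nat) (v : T) :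
    {set 'I_K} :=
  [set i | colour i \notin r v].

Lemma low_part_None (T : finType) (K x : nat) (c : {ffun T -> 'I_x}) (v : T) :
  (low_part K c v == None) = (K <= c v).
Proof.
by rewrite ffunE leqNgt; case: insubP => [i ->|->].
Qed.

Lemma low_part_eq (T : finType) (K x : nat) (c : {ffun T -> 'I_x}) (u v : T) :
  c u < K -> (low_part K c u == low_part K c v) = (c u == c v).
Proof.
move=> lt_u; apply/eqP/eqP => [|eq_c]; last by rewrite !ffunE eq_c.
rewrite !ffunE insubT /=; case: insubP => //= i lt_v val_i [eq_i].
by apply: val_inj; rewrite /= -val_i -eq_i.
Qed.

Lemma permitted_proper_split (T : finType) (e : rel T) (r : restraint T)
    (K x : nat) (c : {ffun T -> 'I_x}) :
  (forall v i, i \in r v -> 1 <= i <= K) ->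
  proper_colouring e c && permitted r c =
  low_admissible e r (low_part K c) && proper_above e K c.
Proof.
move=> r_le; apply/andP/andP.
- case=> /forallP prop /forallP perm; split; last first.
    apply/forallP => u; apply/forallP => v.
    move/forallP/(_ v)/implyP: (prop u) => prop_uv.
    by apply/implyP => /prop_uv ->; case: leqP.
  apply/andP; split; apply/forallP => u.
    rewrite ffunE; case: insubP => // i _ /= eq_i.
    by move: (perm u); rewrite /colour eq_i.
  apply/forallP => v; apply/implyP => euv; apply/implyP.
  rewrite low_part_None -ltnNge => lt_u.
  by rewrite low_part_eq //; move/forallP/(_ v)/implyP: (prop u); apply.
- case=> /andP [/forallP perm /forallP prop] /forallP above; split.
    apply/forallP => u; apply/forallP => v; apply/implyP => euv.
    case: (leqP K (c u)) => [le_u|lt_u].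
      by move/forallP/(_ v): (above u); rewrite euv le_u.
    move/forallP/(_ v): (prop u).
    by rewrite euv low_part_None -ltnNge lt_u /= low_part_eq.
  apply/forallP => v; apply/negP => in_r.
  have /andP [_ lt_v] := r_le _ _ in_r.
  move: (perm v); rewrite ffunE; case: insubP => [i _ /= eq_i|].
    by rewrite /colour eq_i in_r.
  by rewrite lt_v.
Qed.

(** Replacing the low colours of [c] by those prescribed by [d'] is injective on the extensions of
    [d]. It keeps properness above [K], since a high colour never meets a low one. *)
Lemma leq_extensions (T : finType) (e : rel T) (K x : nat)
    (d d' : {ffun T -> option 'I_K}) :
  K <= x -> low_support d = low_support d' ->
  #|extensions e x d| <= #|extensions e x d'|.
Proof.
move=> le_Kx eq_supp.
have suppE v : (d v == None) = (d' v == None).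
  by move/setP/(_ v): eq_supp; rewrite !inE => /negb_inj.
pose f (c : {ffun T -> 'I_x}) : {ffun T -> 'I_x} :=
  [ffun v => if d' v is Some i then widen_ord le_Kx i else c v].
have f_inj : {in extensions e x d &, injective f}.
  move=> c1 c2; rewrite !inE => /andP [/eqP eq1 _] /andP [/eqP eq2 _] eq_f.
  apply/ffunP => v; case E: (d v) => [i|].
    have lt1 : c1 v < K by rewrite ltnNge -low_part_None eq1 E.
    have /ffunP /(_ v) := etrans eq1 (esym eq2).
    rewrite !ffunE; case: insubP => [i1 _ val1|]; last by rewrite lt1.
    case: insubP => //= i2 _ val2 [eq_i].
    by apply: val_inj; rewrite /= -val1 -val2 eq_i.
  have /eqP E' : d' v == None by rewrite -suppE E.
  by move/ffunP/(_ v): eq_f; rewrite !ffunE E'.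
rewrite -(card_in_imset f_inj); apply/subset_leq_card/subsetP => c'.
case/imsetP => c; rewrite !inE => /andP [/eqP eq_c /forallP above] ->; apply/andP; split.
  apply/eqP/ffunP => v; rewrite !ffunE.
  case E: (d' v) => [i|] /=; first exact: (valK i).
  by have := suppE v; rewrite E -eq_c ffunE eqxx => /eqP.
apply/forallP => u; apply/forallP => v; apply/implyP => euv; apply/implyP.
rewrite !ffunE; case E: (d' u) => [i|] /=; first by rewrite leqNgt ltn_ord.
move=> le_u; case E': (d' v) => [j|].
  by apply: contraTneq le_u => ->; rewrite -ltnNge /=.
by move/forallP/(_ v): (above u); rewrite euv le_u.
Qed.

Lemma extensions_high_count (T : finType) (e : rel T) (K x : nat)
    (d : {ffun T -> option 'I_K}) :
  K <= x ->
  #|extensions e x d| = high_count e K x (low_support d).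
Proof.
move=> le_Kx; apply/eqP; rewrite eqn_leq; apply/andP; split.
  exact: (leq_bigmax_cond (F := fun d => #|extensions e x d|)).
by apply/bigmax_leqP => d' /eqP; apply: leq_extensions.
Qed.

Lemma restrained_count_split (T : finType) (e : rel T) (r : restraint T)
    (K x : nat) :
  K <= x -> (forall v i, i \in r v -> 1 <= i <= K) ->
  restrained_count e r x =
  \sum_(W : {set T}) low_count e r K W * high_count e K x W.
Proof.
move=> le_Kx r_le.
rewrite /restrained_count -sum1_card.
under eq_bigl => c do rewrite inE (permitted_proper_split e c r_le).
rewrite (partition_big (fun c => low_part K c)
  (fun d => low_admissible e r d)) /=; last by move=> c /andP [].
rewrite (partition_big (fun d => low_support d) predT) //=.
apply: eq_bigr => W _; rewrite /low_count -sum1_card big_distrl /=.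
rewrite [RHS](eq_bigl (fun d => low_admissible e r d && (low_support d == W)));
  last by move=> d; rewrite inE.
apply: eq_bigr => d /andP [ok_d /eqP <-].
rewrite mul1n -extensions_high_count // -sum1_card; apply: eq_bigl => c.
by rewrite inE andbC; case: eqP => //= ->; rewrite ok_d.
Qed.

(** * Upper and lower bounds on the number of high extensions *)

Lemma card_family_prod (T U : finType) (F : T -> pred U) :
  #|[set c : {ffun T -> U} | [forall v, F v (c v)]]| = \prod_v #|F v|.
Proof.
transitivity #|(family F : simpl_pred {ffun T -> U})|; last first.
  by rewrite card_family foldrE big_map big_enum.
apply: eq_card => c; rewrite inE.
by apply/forallP/familyP.
Qed.

(** Turns both bounds on [extensions] into comparisons of products, vertex by vertex. *)
Lemma prod_support (T : finType) (K q : nat) (d : {ffun T -> option 'I_K}) :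
  \prod_v (if d v is Some _ then 1 else q) = q ^ (#|T| - #|low_support d|).
Proof.
rewrite (bigID (fun v => d v == None)) /= [X in _ * X]big1 ?muln1; last first.
  by move=> v; case: (d v).
rewrite (eq_bigr (fun=> q)) => [|v /eqP -> //].
rewrite prod_nat_const; congr (q ^ _).
rewrite -(cardsC (low_support d)) addKn.
by apply: eq_card => v; rewrite !inE negbK.
Qed.

Lemma card_ord_range (x a b : nat) :
  b <= x -> #|[pred i : 'I_x | a <= i < b]| = b - a.
Proof.
move=> le_bx; rewrite -sum1_card.
transitivity (\sum_(i < x | (i < b) && (a <= i)) 1).
  by apply: eq_bigl => i; rewrite inE andbC.
rewrite -[LHS](big_geq_mkord a x (fun i => i < b) (fun=> 1)).
have -> : \sum_(a <= i < x | i < b) 1 = \sum_(a <= i < b) 1.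
  by rewrite (big_nat_widen _ _ _ _ _ le_bx).
by rewrite sum_nat_const_nat muln1.
Qed.

(** Dropping properness, a low vertex has its colour forced and a high one has [x - K] choices. *)
Lemma extensions_upper (T : finType) (e : rel T) (K x : nat)
    (d : {ffun T -> option 'I_K}) :
  #|extensions e x d| <= (x - K) ^ (#|T| - #|low_support d|).
Proof.
rewrite -prod_support.
apply: (@leq_trans (\prod_v #|[pred i : 'I_x | insub (i : nat) == d v]|)).
  rewrite -card_family_prod; apply/subset_leq_card/subsetP => c.
  rewrite !inE => /andP [/eqP <- _]; apply/forallP => v.
  by rewrite ffunE /=.
apply: leq_prod => v _; case: (d v) => [j|].
  apply/card_le1_eqP => i1 i2; rewrite !inE.
  case: insubP => // j1 _ val1 /eqP [eq1].
  case: insubP => // j2 _ val2 /eqP [eq2].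
  by apply: val_inj; rewrite /= -val1 -val2 eq1 eq2.
rewrite -(card_ord_range K (leqnn x)); apply/subset_leq_card/subsetP => i.
by rewrite !inE ltn_ord andbT; case: insubP => //; rewrite -leqNgt.
Qed.

(* Giving every vertex its own block of q high colours makes the colouring
   proper above K for free. *)
Lemma extensions_lower (T : finType) (e : rel T) (K x q : nat)
    (d : {ffun T -> option 'I_K}) :
  irreflexive e -> K + #|T| * q <= x ->
  q ^ (#|T| - #|low_support d|) <= #|extensions e x d|.
Proof.
move=> e_irr le_x; rewrite -prod_support.
pose lo (v : T) := K + enum_rank v * q.
have hi_le v : lo v + q <= x.
  apply: leq_trans le_x; rewrite /lo -addnA leq_add2l -mulSnr leq_mul2r.
  by rewrite ltn_ord orbT.
pose F v := if d v is Some j then [pred i : 'I_x | i == j :> nat]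
            else [pred i : 'I_x | lo v <= i < lo v + q].
apply: (@leq_trans (\prod_v #|F v|)).
  apply: leq_prod => v _; rewrite /F; case: (d v) => [j|].
    have lt_j : j < x.
      by apply: leq_trans (ltn_ord j) _; apply: leq_trans (leq_addr _ _) le_x.
    by apply/card_gt0P; exists (Ordinal lt_j); rewrite inE.
  by rewrite card_ord_range // addKn.
rewrite -card_family_prod; apply/subset_leq_card/subsetP => c.
rewrite !inE => /forallP Fc.
have lowE : low_part K c = d.
  apply/ffunP => v; rewrite ffunE; move: (Fc v); rewrite /F.
  case: (d v) => [j /= /eqP ->|/= /andP [le_c _]].
    exact: (valK j).
  by rewrite insubN // -leqNgt (leq_trans _ le_c) ?leq_addr.
rewrite lowE eqxx; apply/forallP => u; apply/forallP => v.
apply/implyP => euv; apply/implyP => le_u; apply/eqP => eq_c.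
have le_v : K <= c v by rewrite -eq_c.
move: (Fc u) (Fc v); rewrite /F.
move/eqP: (etrans (low_part_None K c u) le_u); rewrite lowE => ->.
move/eqP: (etrans (low_part_None K c v) le_v); rewrite lowE => ->.
rewrite /= -eq_c /lo => /andP [a1 a2] /andP [b1 b2].
have : enum_rank u != enum_rank v.
  by apply: contraTneq euv => /enum_rank_inj ->; rewrite e_irr.
rewrite -val_eqE /= neq_ltn => /orP [] lt_r.
- have : (enum_rank u).+1 * q <= enum_rank v * q by rewrite leq_mul2r lt_r orbT.
  rewrite mulSn; lia.
- have : (enum_rank v).+1 * q <= enum_rank u * q by rewrite leq_mul2r lt_r orbT.
  rewrite mulSn; lia.
Qed.

(** * Low colourings of at most two vertices *)

Lemma card_free_colours (T : finType) (r : restraint T) (k K : nat) (v : T) :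
  #|` r v| = k -> (forall i, i \in r v -> 1 <= i <= K) ->
  #|free_colours r K v| = K - k.
Proof.
move=> card_r r_le; rewrite -[K in RHS]card_ord.
rewrite -(cardsC (free_colours r K v)) -[X in _ - X]card_r.
suff -> : #|` r v| = #|~: free_colours r K v| by rewrite addnK.
rewrite cardE -(size_map (@colour K)); apply/perm_size/uniq_perm.
- exact: fset_uniq.
- by rewrite map_inj_uniq ?enum_uniq // => i j [] /val_inj.
move=> i; apply/idP/mapP => [in_r|[j]]; last first.
  by rewrite mem_enum !inE negbK => ? ->.
have /andP [i_gt0 le_i] := r_le _ in_r.
have lt_i : i.-1 < K by rewrite prednK.
by exists (Ordinal lt_i); rewrite ?mem_enum ?inE /colour /= prednK // negbK.
Qed.

Lemma free_colours_inj (T : finType) (r : restraint T) (K : nat) (u v : T) :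
  (forall w i, i \in r w -> 1 <= i <= K) ->
  free_colours r K u = free_colours r K v -> r u = r v.
Proof.
move=> r_le eq_free; apply/fsetP => i.
have [i_bad|] := boolP (1 <= i <= K); last first.
  by move=> i_out; apply/idP/idP => /r_le; rewrite (negbTE i_out).
case/andP: i_bad => i_gt0 le_i; have lt_i : i.-1 < K by rewrite prednK.
move/setP/(_ (Ordinal lt_i)): eq_free.
by rewrite !inE /colour /= prednK // => /negb_inj.
Qed.

Lemma low_count0 (T : finType) (e : rel T) (r : restraint T) (K : nat) :
  low_count e r K set0 = 1.
Proof.
apply/eqP/cards1P; exists [ffun=> None]; apply/setP => d; rewrite !inE.
apply/andP/eqP => [[_ /eqP supp_d]|->].
  apply/ffunP => v; rewrite ffunE; apply/eqP.
  by move/setP/(_ v): supp_d; rewrite !inE => /negbFE.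
split; last by apply/eqP/setP => v; rewrite !inE ffunE.
apply/andP; split; apply/forallP => u; first by rewrite ffunE.
by apply/forallP => v; rewrite !ffunE implybT.
Qed.

Lemma low_count1 (T : finType) (e : rel T) (r : restraint T) (K : nat) (u : T) :
  irreflexive e -> low_count e r K [set u] = #|free_colours r K u|.
Proof.
move=> e_irr.
pose f (i : 'I_K) : {ffun T -> option 'I_K} :=
  [ffun w => if w == u then Some i else None].
have f_inj : injective f.
  move=> i j /ffunP /(_ u); rewrite !ffunE eqxx; by case.
rewrite -(card_imset _ f_inj); apply: eq_card => d; rewrite inE.
apply/andP/imsetP => [[/andP [/forallP perm _] /eqP supp_d]|[i free_i ->]].
  case E: (d u) => [i|]; last first.
    by move/setP/(_ u): supp_d; rewrite !inE E !eqxx.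
  exists i; first by move: (perm u); rewrite E inE.
  apply/ffunP => w; rewrite ffunE; case: eqP => [-> //|/eqP neq_w].
  by move/setP/(_ w): supp_d; rewrite !inE (negbTE neq_w) => /negbFE /eqP.
split; last by apply/eqP/setP => w; rewrite !inE ffunE; case: (w == u).
apply/andP; split; apply/forallP => w.
  by rewrite ffunE; case: eqP => // ->; move: free_i; rewrite inE.
apply/forallP => w'; apply/implyP => eww'; rewrite !ffunE.
case: (eqVneq w u) => // eq_w; case: (eqVneq w' u) => // eq_w'.
by move: eww'; rewrite eq_w eq_w' e_irr.
Qed.

(** Among all pairs of free colours, an edge excludes the equal pairs, one for each common free
    colour. The additive form avoids truncated subtraction. *)
Lemma low_count2 (T : finType) (e : rel T) (r : restraint T) (K : nat) (u v : T) :
  symmetric e -> irreflexive e -> u != v ->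
  low_count e r K [set u; v]
    + (if e u v then #|free_colours r K u :&: free_colours r K v| else 0)
  = #|free_colours r K u| * #|free_colours r K v|.
Proof.
move=> e_sym e_irr neq_uv.
pose f (p : 'I_K * 'I_K) : {ffun T -> option 'I_K} :=
  [ffun w => if w == u then Some p.1 else if w == v then Some p.2 else None].
have fu p : f p u = Some p.1 by rewrite ffunE eqxx.
have fv p : f p v = Some p.2 by rewrite ffunE eq_sym (negbTE neq_uv) eqxx.
have f_inj : injective f.
  move=> [i j] [i' j'] /ffunP eq_f.
  by move: (eq_f u) (eq_f v); rewrite !fu !fv => -[->] [->].
(* The pairs excluded by the edge; empty if [u] and [v] are not adjacent. *)
pose B := [set p : 'I_K * 'I_K | e u v && (p.1 == p.2)].
rewrite -cardsX -(cardsID B) addnC; congr (_ + _).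
  case: ifP => euv; last by rewrite (_ : _ :&: B = set0) ?cards0 //;
    apply/setP => p; rewrite !inE euv andbF.
  rewrite -(card_imset (f := fun i => (i, i))) => [|i j [] //].
  apply: eq_card => -[i j]; rewrite !inE euv /=; apply/imsetP/andP.
    by case=> i' /setIP []; rewrite !inE => iu iv [-> ->]; rewrite iu iv eqxx.
  by case=> /andP [iu jv] /eqP eq_ij; exists i; rewrite ?inE eq_ij ?jv -?eq_ij ?iu.
rewrite -(card_imset _ f_inj); apply: eq_card => d; rewrite inE.
apply/andP/imsetP => [[/andP [/forallP perm /forallP prop] /eqP supp_d]|[[i j] + ->]].
  have some w : w \in [set u; v] -> exists i, d w = Some i.
    by rewrite -supp_d inE; case: (d w) => // i; exists i.
  have [i Ei] := some _ (set21 u v); have [j Ej] := some _ (set22 u v).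
  exists (i, j).
    rewrite !inE /=; move: (perm u) (perm v); rewrite Ei Ej => -> ->.
    rewrite !andbT; apply/negP => /andP [euv /eqP eq_ij].
    by move/forallP/(_ v): (prop u); rewrite euv Ei Ej eq_ij eqxx.
  apply/ffunP => w; rewrite ffunE; case: eqP => [-> //|/eqP neq_u].
  case: eqP => [-> //|/eqP neq_v].
  by move/setP/(_ w): supp_d; rewrite !inE (negbTE neq_u) (negbTE neq_v) => /negbFE /eqP.
rewrite !inE /= => /andP [nB /andP [iu jv]]; split; last first.
  apply/eqP/setP => w; rewrite !inE ffunE.
  by case: (w == u) => //; case: (w == v).
apply/andP; split; apply/forallP => w.
  by rewrite ffunE; case: eqP => [->|_] //; case: eqP => [->|].
apply/forallP => w'; apply/implyP => eww'; rewrite !ffunE /=.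
case: (eqVneq w u) => [eq_w|_]; last case: (eqVneq w v) => [eq_w|//].
- case: (eqVneq w' u) => [eq_w'|_]; first by move: eww'; rewrite eq_w eq_w' e_irr.
  case: (eqVneq w' v) => [eq_w'|//].
  by move: nB; rewrite -eq_w -eq_w' eww' /=.
- case: (eqVneq w' u) => [eq_w'|_].
    by move: nB; rewrite -eq_w -eq_w' e_sym eww' /= eq_sym.
  by case: (eqVneq w' v) => [eq_w'|//]; move: eww'; rewrite eq_w eq_w' e_irr.
Qed.

(** Only edges can make a difference: their endpoints share at most [K - k] free colours, and a
    restraint constant along edges attains this bound. *)
Lemma low_count_le (T : finType) (e : rel T) (k : nat) (r r' : restraint T)
    (W : {set T}) :
  symmetric e -> irreflexive e -> k_restraint k r -> k_restraint k r' ->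
  edge_constant e r -> #|W| <= 2 ->
  low_count e r (k * #|T|) W <= low_count e r' (k * #|T|) W.
Proof.
move=> e_sym e_irr r_k r'_k r_const; set K := k * #|T|.
have card_r v : #|free_colours r K v| = K - k.
  by have [? ?] := r_k v; apply: card_free_colours.
have card_r' v : #|free_colours r' K v| = K - k.
  by have [? ?] := r'_k v; apply: card_free_colours.
rewrite leq_eqVlt ltnS leq_eqVlt ltnS leqn0 => /or3P [].
- case/cards2P => u [v [neq_uv ->]].
  have := low_count2 r K e_sym e_irr neq_uv.
  have := low_count2 r' K e_sym e_irr neq_uv.
  rewrite !card_r !card_r'; case: ifP => [euv|_]; last by lia.
  have := subset_leq_card (subsetIl (free_colours r' K u) (free_colours r' K v)).
  have -> : free_colours r K u = free_colours r K v
    by rewrite /free_colours (r_const _ _ euv).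
  rewrite setIid card_r card_r'; lia.
- by case/cards1P => u ->; rewrite !low_count1 // card_r card_r'.
- by rewrite cards_eq0 => /eqP ->; rewrite !low_count0.
Qed.

(** Sharing [K - k] free colours would force the two free sets of [r'], both of that size, to
    coincide, and hence [r' u = r' v]. *)
Lemma low_count_edge_lt (T : finType) (e : rel T) (k : nat) (r r' : restraint T)
    (u v : T) :
  symmetric e -> irreflexive e -> k_restraint k r -> k_restraint k r' ->
  edge_constant e r -> e u v -> r' u <> r' v ->
  low_count e r (k * #|T|) [set u; v] < low_count e r' (k * #|T|) [set u; v].
Proof.
move=> e_sym e_irr r_k r'_k r_const euv neq_r'; set K := k * #|T|.
have card_r w : #|free_colours r K w| = K - k.
  by have [? ?] := r_k w; apply: card_free_colours.
have card_r' w : #|free_colours r' K w| = K - k.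
  by have [? ?] := r'_k w; apply: card_free_colours.
have neq_uv : u != v by apply: contraTneq euv => ->; rewrite e_irr.
have := low_count2 r K e_sym e_irr neq_uv.
have := low_count2 r' K e_sym e_irr neq_uv.
rewrite !card_r !card_r' euv.
have -> : free_colours r K u = free_colours r K v
    by rewrite /free_colours (r_const _ _ euv).
rewrite setIid card_r.
suff : #|free_colours r' K u :&: free_colours r' K v| < K - k by lia.
rewrite -{1}(card_r' u); apply: proper_card; rewrite properEneq subsetIl andbT.
apply/eqP => /setIidPl sub_uv; apply: neq_r'.
apply: (@free_colours_inj _ _ K); first by move=> w; have [] := r'_k w.
by apply/eqP; rewrite eqEcard sub_uv !card_r' /=.
Qed.

(** * Strict comparison for large [x] *)

Lemma restrained_count_lt (T : finType) (e : rel T) (k : nat) (r r' : restraint T)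
    (u v : T) :
  symmetric e -> irreflexive e -> k_restraint k r -> k_restraint k r' ->
  edge_constant e r -> e u v -> r' u <> r' v ->
  exists N, forall x, N <= x -> restrained_count e r x < restrained_count e r' x.
Proof.
move=> e_sym e_irr r_k r'_k r_const euv neq_r'.
set n := #|T|; set K := k * n.
have neq_uv : u != v by apply: contraTneq euv => ->; rewrite e_irr.
pose W0 := [set u; v]; have card_W0 : #|W0| = 2 by rewrite cards2 neq_uv.
have n_gt0 : 0 < n by apply/card_gt0P; exists u.
pose S := \sum_(W : {set T}) low_count e r K W.
(* Chosen so that [q >= Q] gives [S * (2 * n) ^ n < q], which is what [tail] needs. *)
pose Q := (S * (2 * n) ^ n).+1.
exists (K + n * Q) => x le_x.
have le_Kx : K <= x by apply: leq_trans le_x; apply: leq_addr.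
(* The largest size for which [n] disjoint blocks fit among the high colours. As [q >= 1], the bound
   [x - K < n * (q + 1)] gives [x - K <= 2 * n * q]. *)
pose q := (x - K) %/ n.
have le_Qq : Q <= q by rewrite leq_divRL // mulnC; lia.
have le_q : K + n * q <= x by rewrite -(subnKC le_Kx) leq_add2l mulnC leq_divM.
have le_y : x - K <= 2 * n * q.
  apply: ltnW; apply: leq_trans (ltn_ceil (x - K) n_gt0) _; rewrite -/q mulnC.
  by rewrite [2 * n]mulnC -mulnA leq_mul2l; apply/orP; right; lia.
have lt_W0 : low_count e r K W0 < low_count e r' K W0 by apply: low_count_edge_lt.
(* Some [d] must realise [W0] for the lower bound on extensions to apply to [h W0]; the strict
   inequality makes the count for [r'] positive and so supplies one. *)
have [d0] : exists d : {ffun T -> option 'I_K}, low_support d = W0.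
  have /card_gt0P [d] : 0 < low_count e r' K W0 by apply: leq_ltn_trans lt_W0.
  by rewrite inE => /andP [_ /eqP]; exists d.
move=> supp_d0; pose h := high_count e K x.
have h_lower : q ^ (n - 2) <= h W0.
  rewrite -card_W0 -supp_d0 /h -extensions_high_count //.
  exact: extensions_lower.
(* With at least three low vertices, [(2 * n * q) ^ (n - #|W|) * q] has exponent at most [n - 2] in
   [q], so the lower bound on [h W0] dominates it up to a constant. *)
have h_upper (W : {set T}) : 2 < #|W| -> h W * q <= (2 * n) ^ n * h W0.
  move=> W_gt2; apply: leq_trans (leq_mul (leqnn _) h_lower).
  have le_Wn : #|W| <= n by apply: max_card.
  apply: (@leq_trans ((2 * n * q) ^ (n - #|W|) * q)).
    rewrite leq_mul2r; apply/orP; right; apply/bigmax_leqP => d /eqP <-.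
    apply: leq_trans (extensions_upper _ _ _) _.
    by rewrite -/n; case: (n - _) => // m; rewrite leq_exp2r.
  rewrite expnMn -mulnA -expnSr; apply: leq_mul.
    by rewrite leq_pexp2l ?muln_gt0 ?leq_subr.
  by rewrite leq_pexp2l //; lia.
have r_le w i : i \in r w -> 1 <= i <= K by have [_] := r_k w; apply.
have r'_le w i : i \in r' w -> 1 <= i <= K by have [_] := r'_k w; apply.
rewrite (restrained_count_split e le_Kx r_le).
rewrite (restrained_count_split e le_Kx r'_le) -/h.
rewrite (bigID (fun W : {set T} => #|W| <= 2)).
rewrite [X in _ < X](bigID (fun W : {set T} => #|W| <= 2)) /=.
(* Multiplied by [q], the sum is at most [S * (2 * n) ^ n * h W0], which is below [q * h W0]. *)
have tail : \sum_(W : {set T} | ~~ (#|W| <= 2)) low_count e r K W * h W < h W0.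
  have q_gt0 : 0 < q by apply: leq_trans le_Qq.
  have h_gt0 : 0 < h W0 by apply: leq_trans h_lower; rewrite expn_gt0 q_gt0.
  rewrite -(ltn_pmul2r q_gt0) big_distrl /=.
  apply: (@leq_ltn_trans (S * ((2 * n) ^ n * h W0))); last first.
    by rewrite mulnA [X in _ < X]mulnC ltn_pmul2r.
  rewrite /S big_distrl [X in _ <= X](bigID (fun W : {set T} => #|W| <= 2)) /=.
  apply: leq_trans (leq_addl _ _); apply: leq_sum => W; rewrite -ltnNge => W_gt2.
  by rewrite -mulnA leq_mul2l h_upper ?orbT.
(* The large sets are discarded on the side of [r']. The one extra low colouring of [W0] contributes
   [h W0] and so outweighs [tail]. *)
apply: leq_trans (leq_addr _ _).
rewrite (bigD1 W0) ?card_W0 //= [X in _ < X](bigD1 W0) ?card_W0 //=.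
have le_rest : \sum_(W : {set T} | (#|W| <= 2) && (W != W0)) low_count e r K W * h W
    <= \sum_(W : {set T} | (#|W| <= 2) && (W != W0)) low_count e r' K W * h W.
  apply: leq_sum => W /andP [W_le2 _]; rewrite leq_mul2r; apply/orP; right.
  exact: low_count_le.
have : (low_count e r K W0).+1 * h W0 <= low_count e r' K W0 * h W0.
  by rewrite leq_mul2r lt_W0 orbT.
rewrite mulSn => le_W0; apply: leq_trans (leq_add le_W0 le_rest).
by rewrite -[X in _ < X]addnA [X in _ < X]addnC ltn_add2l.
Qed.

(** * Restraints constant along edges *)

(** List each set followed by its complement and match equal positions: the first [#|A| = #|B|]
    positions are those of the sets. *)
Lemma exists_inj_mapping_set (U : finType) (A B : {set U}) :
  #|A| = #|B| ->
  exists2 f : U -> U, injective f & forall x, (f x \in B) = (x \in A).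
Proof.
move=> eq_AB.
pose s (C : {set U}) := enum C ++ enum (~: C).
have s_mem C x : x \in s C by rewrite mem_cat !mem_enum inE orbN.
have s_uniq C : uniq (s C).
  rewrite cat_uniq !enum_uniq andbT /=; apply/hasPn => x.
  by rewrite !mem_enum inE.
have s_size C : size (s C) = #|U| by rewrite size_cat -!cardE cardsC.
have lt_index C x : index x (s C) < #|U| by rewrite -(s_size C) index_mem.
(* The default [x] is never reached, since both lists have length [#|U|]; this also lets
   [set_nth_default] exchange the defaults [x] and [y]. *)
exists (fun x => nth x (s B) (index x (s A))) => [x y|x].
  move=> eq_xy; have lt_x := lt_index A x; have lt_y := lt_index A y.
  have : index x (s A) == index y (s A).
    rewrite -(nth_uniq x (s := s B)) ?s_size //; apply/eqP.
    by rewrite eq_xy; apply: set_nth_default; rewrite s_size.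
  move/eqP => eq_i.
  by rewrite -[x](nth_index x (s_mem A x)) eq_i nth_index.
rewrite nth_cat -cardE -eq_AB.
have -> : (index x (s A) < #|A|) = (x \in A).
  rewrite index_cat mem_enum cardE; case: ifP => xA; first by rewrite index_mem mem_enum.
  by rewrite ltnNge leq_addr.
case: ifP => xA.
  rewrite -mem_enum mem_nth // -cardE -eq_AB /s index_cat mem_enum xA.
  by rewrite cardE index_mem mem_enum.
apply/negbTE; rewrite -in_setC -mem_enum mem_nth // -cardE.
rewrite -(ltn_add2l #|B|) cardsC /s -eq_AB subnKC ?lt_index //.
by rewrite index_cat mem_enum xA -cardE leq_addr.
Qed.

(** Recolour each vertex by an injection carrying the free colours of [r] to those of [r']. Adjacent
    vertices use the same injection, so properness survives. *)
Lemma restrained_count_le_edge_constant (T : finType) (e : rel T) (k x : nat)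
    (r r' : restraint T) :
  k_restraint k r -> k_restraint k r' -> edge_constant e r ->
  edge_constant e r' -> k * #|T| <= x ->
  restrained_count e r x <= restrained_count e r' x.
Proof.
move=> r_k r'_k r_const r'_const le_x.
have card_free (s : restraint T) v :
    k_restraint k s -> #|free_colours s x v| = x - k.
  move=> s_k; have [card_s s_le] := s_k v; apply: card_free_colours => // i.
  by move=> /s_le /andP [-> le_i]; apply: leq_trans le_x.
(* The injection is chosen for each pair of colour sets, not for each vertex, so vertices with equal
   restraints receive the same one. For pairs of unequal size the identity is a dummy. *)
have /fin_all_exists [f f_spec] (AB : {set 'I_x} * {set 'I_x}) :
    exists f : {ffun 'I_x -> 'I_x}, #|AB.1| = #|AB.2| ->
      injective f /\ forall i, (f i \in AB.2) = (i \in AB.1).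
  have [eq_card|] := eqVneq #|AB.1| #|AB.2|; last first.
    by move/eqP => neq; exists [ffun i => i].
  have [g g_inj gP] := exists_inj_mapping_set eq_card.
  exists (finfun g) => _; split=> [i j|i]; last by rewrite ffunE gP.
  by rewrite !ffunE => /g_inj.
pose F v := f (free_colours r x v, free_colours r' x v).
have [F_inj FP] : (forall v, injective (F v)) /\
    forall v i, (F v i \in free_colours r' x v) = (i \in free_colours r x v).
  have FPv v := f_spec (free_colours r x v, free_colours r' x v)
    (etrans (card_free r v r_k) (esym (card_free r' v r'_k))).
  by split=> v; have [] := FPv v.
pose g (c : {ffun T -> 'I_x}) : {ffun T -> 'I_x} := [ffun v => F v (c v)].
have g_inj : injective g.
  move=> c c' /ffunP eq_g; apply/ffunP => v; apply: (F_inj v).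
  by have := eq_g v; rewrite !ffunE.
rewrite /restrained_count -(card_imset _ g_inj).
apply/subset_leq_card/subsetP => c' /imsetP [c].
rewrite !inE => /andP [/forallP prop /forallP perm] ->; apply/andP; split.
  apply/forallP => u; apply/forallP => v; apply/implyP => euv; rewrite !ffunE.
  have -> : F u = F v
    by rewrite /F /free_colours (r_const _ _ euv) (r'_const _ _ euv).
  rewrite (inj_eq (F_inj v)).
  by move/forallP/(_ v)/implyP: (prop u); apply.
by apply/forallP => v; have := FP v (c v); rewrite !inE !ffunE perm.
Qed.

(** * From edges to components, and the characterisation *)

(** Constancy propagates along paths by induction; conversely both endpoints of an edge lie in the
    class of the first. *)
Lemma edge_constant_components (T : finType) (e : rel T) (r : restraint T) :
  edge_constant e r <->
  (forall H : {set T}, H \in components e ->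
     forall u u' : T, u \in H -> u' \in H -> r u = r u').
Proof.
split=> [r_const H /imsetP [w _ ->] u u'|r_comp u v euv].
  have to_w v : connect e w v -> r v = r w.
    case/connectP => p; elim: p w => [w _ -> //|a p IHp w /= /andP [ewa pth] lst].
    by rewrite (IHp a pth lst) (r_const _ _ ewa).
  by rewrite !inE /= => /to_w -> /to_w ->.
pose H := [set w in [set: T] | connect e u w].
apply: (r_comp H); rewrite ?inE ?connect0 ?connect1 //.
by apply/imsetP; exists u.
Qed.

Theorem corollary3p4 (T : finType) (e : rel T)
    (e_sym : symmetric e) (e_irr : irreflexive e)
    (k : nat) (k_gt0 : 0 < k)
    (r : restraint T) (r_k : k_restraint k r) :
  Rmin e k r <->
  (forall H : {set T}, H \in components e ->
     forall u u' : T, u \in H -> u' \in H -> r u = r u').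
Proof.
rewrite -edge_constant_components; split=> [[_ r_min] u v euv|r_const].
  apply/eqP/negPn/negP => /eqP neq_r.
  (* A globally constant competitor: it would eventually have a strictly smaller count than [r],
     against minimality. *)
  pose r0 : restraint T := fun=> r u.
  have r0_k : k_restraint k r0 by move=> w; apply: r_k.
  have [N1 le_r] := r_min r0 r0_k.
  have [//|N2 lt_r] := restrained_count_lt e_sym e_irr r0_k r_k _ euv neq_r.
  have := leq_trans (lt_r _ (leq_maxr N1 N2)) (le_r _ (leq_maxl N1 N2)).
  by rewrite ltnn.
split=> // r' r'_k.
(* A competitor constant along edges is handled by recolouring; any other one differs along some
   edge and eventually has a strictly larger count. *)
have [r'_const|] := boolP [forall u, forall v, e u v ==> (r' u == r' v)].
  exists (k * #|T|) => x; apply: restrained_count_le_edge_constant => // u v euv.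
  by move/forallP/(_ u)/forallP/(_ v)/implyP/(_ euv)/eqP: r'_const.
case/forallPn => u /forallPn [v]; rewrite negb_imply => /andP [euv /eqP neq_r'].
have [N lt_r] := restrained_count_lt e_sym e_irr r_k r'_k r_const euv neq_r'.
by exists N => x /lt_r /ltnW.
Qed.
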